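(* Let $F:\mathbb{R}^n\to\mathbb{R}^n$ be continuous, let $x^0\in\mathbb{R}^n$ be arbitrary, and consider the proximal point iteration $x^{k+1}=J_{\alpha F}(x^k)=(\mathrm{Id}+\alpha F)^{-1}(x^k)$ with $\alpha>0$. (i) If $F$ is strongly monotone with respect to a norm $\|\cdot\|$ with monotonicity parameter $c>0$, then for every $\alpha\in]0,\infty[$ the iteration converges to the unique zero $x^*$ of $F$, and for every $k\ge0$, $\|x^{k+1}-x^*\|\le\frac{1}{1+\alpha c}\|x^k-x^*\|$. (ii) If $F$ is monotone and globally Lipschitz continuous with respect to a diagonally weighted $\ell_1$ or $\ell_\infty$ norm $\|\cdot\|$, $\mathrm{diagL}(F)\neq0$, and $\{x:F(x)=0\}\neq\emptyset$, then for every $\alpha\in]0,\infty[$ the iteration converges to a zero of $F$.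
   Context: A weak pairing (WP) on $\mathbb{R}^n$ is a map $[\![\cdot,\cdot]\!]:\mathbb{R}^n\times\mathbb{R}^n\to\mathbb{R}$ that is subadditive and continuous in its first argument, satisfies $[\![\alpha x,y]\!]=[\![x,\alpha y]\!]=\alpha[\![x,y]\!]$ for $\alpha\ge0$ and $[\![-x,-y]\!]=[\![x,y]\!]$, $[\![x,x]\!]>0$ for $x\ne0$, and $|[\![x,y]\!]|\le[\![x,x]\!]^{1/2}[\![y,y]\!]^{1/2}$. It is compatible with a norm if $[\![x,x]\!]=\|x\|^2$. WPs are assumed to also satisfy Deimling's inequality $[\![x,y]\!]\le\|y\|\lim_{h\to0^+}h^{-1}(\|y+hx\|-\|y\|)$ and the curve norm derivative formula ($\|x(t)\|D^+\|x(t)\|=[\![\dot x(t),x(t)]\!]$ a.e. for differentiable curves). $F$ is monotone with monotonicity parameter $c\ge0$ w.r.t. $\|\cdot\|$ if for some compatible WP, $-[\![-(F(x)-F(y)),x-y]\!]\ge c\|x-y\|^2$ for all $x,y$ (monotone: $c=0$; strongly monotone: $c>0$). For continuous monotone $F$ and $\alpha>0$, $J_{\alpha F}=(\mathrm{Id}+\alpha F)^{-1}$ is a single-valued map defined on all of $\mathbb{R}^n$. For $\eta\in\mathbb{R}^n_{>0}$, the diagonally weighted norms are $\|x\|_{1,[\eta]}=\sum_i\eta_i|x_i|$ and $\|x\|_{\infty,[\eta]^{-1}}=\max_i|x_i|/\eta_i$. For Lipschitz $F$, $\mathrm{diagL}(F):=\sup_{x\in\mathbb{R}^n\setminus\Omega_F}\max_{i}(DF(x))_{ii}$,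 where $\Omega_F$ is the measure-zero set where $F$ is not differentiable. *)

(* Defs.v *)
From HB Require Import structures.
From mathcomp Require Import all_boot all_order all_algebra.
From mathcomp Require Import all_classical all_reals all_analysis.
Set Implicit Arguments. Unset Strict Implicit. Unset Printing Implicit Defensive.
Import Order.TTheory GRing.Theory Num.Theory.
Import numFieldNormedType.Exports.
Local Open Scope classical_set_scope.
Local Open Scope ring_scope.

Section Defs.
Variables (R : realType) (n : nat).
Local Notation V := 'rV[R]_n.

Definition is_norm (N : V -> R) : Prop :=
  [/\ forall x, N x = 0 -> x = 0,
      forall (a : R) x, N (a *: x) = `|a| * N x &
      forall x y, N (x + y) <= N x + N y].

Definition Dini_upper_right (g : R -> R) (t : R) : \bar R :=
  limf_esup (fun h : R => ((g (t + h) - g t) / h)%:E) (0%R^'+).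

Definition is_weak_pairing (P : V -> V -> R) : Prop :=
  [/\ (forall x1 x2 y, P (x1 + x2) y <= P x1 y + P x2 y),
      (forall y, continuous (fun x => P x y)),
      (forall (a : R) x y, 0 <= a -> P (a *: x) y = a * P x y /\ P x (a *: y) = a * P x y),
      (forall x y, P (- x) (- y) = P x y) &
      (forall x, x != 0 -> 0 < P x x) /\
      (forall x y, `|P x y| <= Num.sqrt (P x x) * Num.sqrt (P y y))].

(* compatible with N, plus Deimling's inequality and the curve norm derivative formula *)
Definition compatible_WP (N : V -> R) (P : V -> V -> R) : Prop :=
  [/\ is_weak_pairing P,
      forall x, P x x = N x ^+ 2,
      forall x y,
        P x y <= N y * lim ((fun h : R => (N (y + h *: x) - N y) / h) @ 0%R^'+) &
      forall gamma : R -> V, (forall t, derivable gamma t 1) ->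
        {ae (@lebesgue_measure R), forall t,
           ((N (gamma t))%:E * Dini_upper_right (fun s => N (gamma s)) t)%E
           = (P (derive1 gamma t) (gamma t))%:E}].

Definition monotone_with (N : V -> R) (F : V -> V) (c : R) : Prop :=
  0 <= c /\ exists P, compatible_WP N P /\
    forall x y, c * N (x - y) ^+ 2 <= - P (- (F x - F y)) (x - y).

Definition lipschitz_wrt (N : V -> R) (F : V -> V) : Prop :=
  exists L : R, forall x y, N (F x - F y) <= L * N (x - y).

Definition wnorm1 (eta : V) (x : V) : R := \sum_(i < n) eta 0 i * `|x 0 i|.
Definition wnorminf (eta : V) (x : V) : R := \big[Num.max/0]_(i < n) (`|x 0 i| / eta 0 i).

Definition diagL (F : V -> V) : R :=
  sup [set r : R | exists x : V, differentiable F x /\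
        r = \big[Num.max/0]_(i < n) ('d F x (delta_mx 0 i) : V) 0 i].

Definition prox_iter (F : V -> V) (alpha : R) (x0 : V) (xs : nat -> V) : Prop :=
  xs 0%N = x0 /\ forall k, xs k.+1 + alpha *: F (xs k.+1) = xs k.

End Defs.

(* Main.v *)
(* Compatibility of the weak pairing with the norm and its Cauchy-Schwarz
   inequality give |d + alpha f| >= (1 + alpha c) |d| for d = x - y and
   f = F x - F y, so the resolvent J contracts by (1 + alpha c)^-1, which settles
   (i). In (ii), J is merely nonexpansive; orbits are bounded, and convergence
   follows from compactness once the steps x_k - x_(k+1) tend to 0. By the
   Goebel-Kirk inequality this holds when J = (1 - t) Id + t T with T
   nonexpansive. Here T = (Id - gamma F) o J, and Id - gamma F is nonexpansive
   for gamma <= 1 / Lip F. The latter is proved without differentiating F: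
   perturbing d to a point where the polyhedral norm is differentiable turns
   |d + alpha f| >= |d| into sign conditions on f, which for the l1 norm are used
   on increments along coordinate axes, and for the linf norm after one
   coordinate has been raised until it attains the norm. *)
Require Import Defs.
From HB Require Import structures.
From mathcomp Require Import all_boot all_order all_algebra.
From mathcomp Require Import all_classical all_reals all_analysis.
From mathcomp Require Import ring lra.
Import Order.TTheory GRing.Theory Num.Theory.
Import numFieldNormedType.Exports.
Local Open Scope classical_set_scope.
Local Open Scope ring_scope.

(** * Equivalence of an arbitrary norm with the ambient sup norm *)

Section Norms.
Set Implicit Arguments. Unset Strict Implicit. Unset Printing Implicit Defensive.
Variables (R : realType) (n : nat) (N : 'rV[R]_n -> R).
Hypothesis Nn : is_norm N.

Lemma is_norm0 : N 0 = 0.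
Proof. by case: Nn => _ NZ _; rewrite -(scale0r 0) NZ normr0 mul0r. Qed.

Lemma is_normN x : N (- x) = N x.
Proof. by case: Nn => _ NZ _; rewrite -scaleN1r NZ normrN1 mul1r. Qed.

Lemma is_norm_distC x y : N (x - y) = N (y - x).
Proof. by rewrite -is_normN opprB. Qed.

Lemma is_norm_ge0 x : 0 <= N x.
Proof.
case: (Nn) => _ _ /(_ x (- x)); rewrite subrr is_norm0 is_normN => h.
by lra.
Qed.

Lemma is_norm_sub x y : N x - N y <= N (x - y).
Proof. by case: (Nn) => _ _ /(_ (x - y) y); rewrite subrK; lra. Qed.

Lemma is_norm_sum (I : Type) (r : seq I) (f : I -> 'rV[R]_n) :
  N (\sum_(i <- r) f i) <= \sum_(i <- r) N (f i).
Proof.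
case: Nn => _ _ ND; elim/big_rec2: _ => [|i a x _ h]; first by rewrite is_norm0.
by apply: le_trans (ND _ _) _; rewrite lerD2l.
Qed.

Lemma is_norm_upper : exists2 C : R, 0 < C & forall x, N x <= C * `|x|.
Proof.
exists (1 + \sum_(i < n) N 'e_i).
  by rewrite ltr_pwDl // sumr_ge0 // => i _; apply: is_norm_ge0.
move=> x; rewrite {1}(row_sum_delta x); apply: le_trans (is_norm_sum _ _) _.
rewrite mulrDl mul1r mulr_suml.
apply: (@le_trans _ _ (\sum_(i < n) N 'e_i * `|x|)).
  apply: ler_sum => i _; case: (Nn) => _ -> _; rewrite mulrC ler_wpM2l ?is_norm_ge0 //.
  rewrite [leRHS]/Num.norm /= mx_normrE.
  by apply: (le_bigmax _ (fun ij : 'I_1 * 'I_n => `|x ij.1 ij.2|) (0, i)).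
by rewrite lerDr.
Qed.

Lemma is_norm_continuous : continuous N.
Proof.
have [C C0 hC] := is_norm_upper => x.
apply/(@cvgrPdist_lt _ _ _ (nbhs x)) => e e0; near=> y.
have hxy : C * `|x - y| < e.
  rewrite mulrC -ltr_pdivlMr //; near: y.
  by apply: (@cvgr_dist_lt _ _ _ (nbhs x) _ id x) => //; rewrite divr_gt0.
apply: le_lt_trans hxy; rewrite ler_norml.
have := hC (x - y); have := is_norm_sub x y; have := is_norm_sub y x.
by rewrite (is_norm_distC y x); lra.
Unshelve. all: by end_near. Qed.

(** The constant is the minimum of [N] over the compact ambient unit sphere; homogeneity extends the
    bound to all vectors. *)
Lemma is_norm_lower : exists2 c : R, 0 < c & forall x, c * `|x| <= N x.
Proof.
case: (Nn) => Neq0 NZ ND.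
pose S := [set x : 'rV[R]_n | `|x| = 1].
have Snorm x : x != 0 -> S (`|x|^-1 *: x).
  by move=> x0; rewrite /S /= normrZ ger0_norm ?invr_ge0 // mulVf ?normr_eq0.
(* An empty sphere leaves only the zero vector, the case [n = 0], and any constant serves. *)
have [S0|/set0P/negP/negPn/eqP S0] := pselect (S !=set0); last first.
  exists 1 => // x; have [->|/Snorm] := eqVneq x 0; last by rewrite S0.
  by rewrite normr0 mulr0 is_norm_ge0.
have Sc : compact S.
  apply: bounded_closed_compact.
    by exists 1; split => // M M1 x /= ->; exact: ltW.
  apply: (@preimage_closed _ _ _ [set 1 : R]); last exact: closed_eq.
  by move=> x _; exact: norm_continuous.
have [z /set_mem Sz hz] := EVT_min_rV S0 Sc (continuous_subspaceT is_norm_continuous).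
have Nz0 : N z != 0.
  by apply/eqP => /Neq0 z0; move: Sz; rewrite z0 /S /= normr0 => /eqP; rewrite eq_sym oner_eq0.
exists (N z); first by rewrite lt_neqAle eq_sym Nz0 is_norm_ge0.
move=> x; have [->|x0] := eqVneq x 0; first by rewrite normr0 mulr0 is_norm_ge0.
have := hz _ (mem_set (Snorm _ x0)); rewrite NZ ger0_norm ?invr_ge0 //.
by rewrite mulrC ler_pdivlMr ?normr_gt0.
Qed.

Lemma is_norm_cvg (u : nat -> 'rV[R]_n) (z : 'rV[R]_n) :
  (N (u k - z) @[k --> \oo] --> 0) -> u @ \oo --> z.
Proof.
have [c c0 hc] := is_norm_lower => h; apply/cvgrPdist_lt => e e0; near=> k.
rewrite distrC -(ltr_pM2l c0); apply: le_lt_trans (hc _) _.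
have : `|0 - N (u k - z)| < c * e.
  by near: k; apply: cvgr_dist_lt => //; rewrite mulr_gt0.
by rewrite sub0r normrN ger0_norm ?is_norm_ge0.
Unshelve. all: by end_near. Qed.

End Norms.

(** * Resolvent orbits: expansivity, contraction, convergence *)

Section ProximalPoint.
Set Implicit Arguments. Unset Strict Implicit. Unset Printing Implicit Defensive.
Variables (R : realType) (n : nat) (N : 'rV[R]_n -> R) (F : 'rV[R]_n -> 'rV[R]_n).
Hypothesis Nn : is_norm N.

(** Subadditivity splits [P d d] along [d = (d + alpha *: f) - alpha *: f]. Cauchy-Schwarz bounds
    the first term by [N (d + alpha *: f) * N d], monotonicity the second by
    [- alpha * c * N d ^+ 2], and one factor [N d] cancels. *)
Lemma monotone_expansive c alpha x y : monotone_with N F c -> 0 <= alpha ->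
  (1 + alpha * c) * N (x - y) <= N (x - y + alpha *: (F x - F y)).
Proof.
move=> [_ [P [[[Psub _ Pscale _ [_ Pcs]] Pnorm _ _]]]] /(_ x y).
set d := x - y; set f := F x - F y => hm alpha0.
have [_ NZ _] := Nn; have N0 := is_norm_ge0 Nn.
have [d0|d0] := eqVneq (N d) 0; first by rewrite d0 mulr0.
have Nd : 0 < N d by rewrite lt_neqAle eq_sym d0 N0.
rewrite -(ler_pM2r Nd).
have h1 : P d d <= P (d + alpha *: f) d + P (- (alpha *: f)) d.
  by rewrite -{1}(addrK (alpha *: f) d) Psub.
have h2 : P (d + alpha *: f) d <= N (d + alpha *: f) * N d.
  apply: le_trans (ler_norm _) _; apply: le_trans (Pcs _ _) _.
  by rewrite !Pnorm !sqrtr_sqr !ger0_norm.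
have h3 : P (- (alpha *: f)) d = alpha * P (- f) d.
  by rewrite -scalerN; case: (Pscale alpha (- f) d alpha0).
have h4 := ler_wpM2l alpha0 hm.
move: h1 h2 h4; rewrite h3 Pnorm; lra.
Qed.

Variables (alpha : R) (x0 : 'rV[R]_n) (xs : nat -> 'rV[R]_n).
Hypothesis alpha0 : 0 < alpha.
Hypothesis xsP : prox_iter F alpha x0 xs.

Lemma prox_iterE k : F (xs k.+1) = alpha^-1 *: (xs k - xs k.+1).
Proof.
case: xsP => _ /(_ k) <-.
by rewrite addrAC subrr add0r scalerA mulVf ?scale1r // gt_eqF.
Qed.

Lemma prox_iter_contract q : 0 < q ->
  (forall u v, q * N (u - v) <= N (u - v + alpha *: (F u - F v))) ->
  (forall i j, N (xs i.+1 - xs j.+1) <= q^-1 * N (xs i - xs j)) /\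
  (forall z k, F z = 0 -> N (xs k.+1 - z) <= q^-1 * N (xs k - z)).
Proof.
move=> q0 hq; case: xsP => _ step; split => [i j|z k Fz0];
  rewrite mulrC ler_pdivlMr // mulrC; apply: le_trans (hq _ _) _.
- by rewrite scalerBr -(step i) -(step j) opprD addrACA.
- by rewrite Fz0 subr0 -(step k) addrAC.
Qed.

(** A cluster point of the bounded orbit is a zero of [F], since [F (xs k.+1)] is a multiple of a
    vanishing step. Distances to a zero never increase, so the whole orbit converges to this cluster
    point. *)
Lemma prox_iter_cvg B : continuous F ->
  (forall u v, N (u - v) <= N (u - v + alpha *: (F u - F v))) ->
  (forall k, N (xs k) <= B) -> N (xs k - xs k.+1) @[k --> \oo] --> 0 ->
  exists z, F z = 0 /\ xs @ \oo --> z.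
Proof.
move=> Fc hF xsB steps; have [c c0 hc] := is_norm_lower Nn.
pose K := [set x : 'rV[R]_n | `|x| <= B / c].
have Kc : compact K.
  apply: bounded_closed_compact.
    by exists (B / c); split; rewrite ?num_real // => M M1 x /= /le_trans; apply; exact: ltW.
  apply: (@preimage_closed _ _ _ [set r : R | r <= B / c]); last exact: closed_le.
  by move=> x _; exact: norm_continuous.
have xsK : (xs @ \oo) K.
  by exists 0%N => // k _; rewrite /K /= ler_pdivlMr // mulrC (le_trans (hc _)).
have [z [_ zcl]] := Kc _ _ xsK.
have Nc := is_norm_continuous Nn.
have Fz : F z = 0.
  case: (Nn) => Neq0 NZ _; apply: Neq0; apply/eqP; rewrite eq_le (is_norm_ge0 Nn) andbT.
  rewrite leNgt; apply/negP => e0; set e := N (F z) in e0.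
  have NFc : {for z, continuous (N \o F)} by apply: continuous_comp; [exact: Fc|exact: Nc].
  have nz : nbhs z [set u | e / 2 < N (F u)].
    have /(_ _ (e / 2)) := cvgr_gt e NFc; apply; lra.
  have ex : (xs @ \oo) [set u | N (F u) < e / 2].
    have /(cvgr_dist_lt)/(_ (alpha * (e / 2))) := steps.
    rewrite mulr_gt0 ?divr_gt0 // => /(_ isT) [k0 _ hk0].
    (* The shift by one appears because the step out of [xs k] measures [F] at [xs k.+1]. *)
    exists k0.+1 => // -[//|k] /= k0k; rewrite prox_iterE NZ ger0_norm ?invr_ge0 ?ltW //.
    have := hk0 k k0k; rewrite /= sub0r normrN (ger0_norm (is_norm_ge0 Nn _)) => h.
    by rewrite mulrC ltr_pdivrMr // mulrC.
  by have [u [/= h1 h2]] := zcl _ _ ex nz; lra.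
exists z; split => //; apply: (is_norm_cvg Nn); apply/cvgrPdist_lt => e e0.
have nz : nbhs z [set u | N (u - z) < e].
  have NBc : {for z, continuous (N \o (fun u => u - z))}.
    apply: continuous_comp; last exact: Nc.
    by apply: (@cvgB _ _ _ (nbhs z)); [exact: cvg_id|exact: cvg_cst].
  by apply: (@cvgr_lt _ _ _ _ (N \o (fun u => u - z)) _ NBc); rewrite /= subrr (is_norm0 Nn).
have ex : (xs @ \oo) (range xs) by exists 0%N => // k _; exists k.
have [_ [[k0 _ <-] /= hk0]] := zcl _ _ ex nz.
have hF1 u v : 1 * N (u - v) <= N (u - v + alpha *: (F u - F v)) by rewrite mul1r.
have [_ mon] := prox_iter_contract ltr01 hF1.
exists k0 => // k /= k0k; rewrite sub0r normrN (ger0_norm (is_norm_ge0 Nn _)).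
apply: le_lt_trans hk0; rewrite -(subnKC k0k).
elim: (k - k0)%N => [|m IH]; first by rewrite addn0.
by rewrite addnS; apply: le_trans (mon _ _ Fz) _; rewrite invr1 mul1r.
Qed.

Lemma prox_iter_strong c : continuous F -> 0 < c -> monotone_with N F c ->
  exists xstar, [/\ F xstar = 0, (forall z, F z = 0 -> z = xstar),
    xs @ \oo --> xstar &
    forall k, N (xs k.+1 - xstar) <= (1 + alpha * c)^-1 * N (xs k - xstar)].
Proof.
move=> Fc c0 Fm; have N0 := is_norm_ge0 Nn; have [Neq0 NZ ND] := Nn.
have ac0 : 0 < alpha * c by rewrite mulr_gt0.
have hq u v := monotone_expansive u v Fm (ltW alpha0).
have q0 : 0 < 1 + alpha * c by rewrite addr_gt0.
have [con zcon] := prox_iter_contract q0 hq.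
set q := (1 + alpha * c)^-1 in con zcon *.
have q1 : q < 1 by rewrite invf_lt1 // ltrDl.
have qge0 : 0 <= q by rewrite invr_ge0 ltW.
have stepq k : N (xs k - xs k.+1) <= N (xs 0%N - xs 1%N) * q ^+ k.
  elim: k => [|k IH]; first by rewrite expr0 mulr1.
  by apply: le_trans (con _ _) _; rewrite exprS mulrCA ler_wpM2l.
(* The bound is the fixed point of [b |-> q * b + N (xs 1 - xs 0)], hence it propagates along the
   orbit. *)
have bnd k : N (xs k - xs 0%N) <= N (xs 1%N - xs 0%N) / (1 - q).
  have q1' : 0 < 1 - q by rewrite subr_gt0.
  elim: k => [|k IH]; first by rewrite subrr is_norm0 // divr_ge0 // ltW.
  rewrite -(subrK (xs 1%N) (xs k.+1)) -addrA; apply: le_trans (ND _ _) _.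
  apply: le_trans (lerD (con _ _) (lexx _)) _.
  apply: le_trans (lerD (ler_wpM2l qge0 IH) (lexx _)) _.
  by rewrite le_eqVlt; apply/orP; left; apply/eqP; field; rewrite gt_eqF.
have [] := @prox_iter_cvg (N (xs 1%N - xs 0%N) / (1 - q) + N (xs 0%N)) Fc.
- move=> u v; apply: le_trans (hq u v); rewrite mulrDl mul1r lerDl.
  by rewrite mulr_ge0 // ltW.
- by move=> k; rewrite -{1}(subrK (xs 0%N) (xs k)); apply: le_trans (ND _ _) _; rewrite lerD2r.
- apply: (@squeeze_cvgr _ _ _ _ (fun=> 0) (fun k => N (xs 0%N - xs 1%N) * q ^+ k)).
  + by near=> k; rewrite N0 stepq.
  + exact: cvg_cst.
  + rewrite -[X in _ --> X](mulr0 (N (xs 0%N - xs 1%N))); apply: cvgMr.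
    by apply: cvg_expr; rewrite ger0_norm.
move=> z [Fz xsz]; exists z; split => //; last by move=> k; exact: zcon.
move=> w Fw; apply/eqP; rewrite -subr_eq0; apply/eqP/Neq0.
have := hq w z; rewrite Fw Fz subrr scaler0 addr0 => h.
apply/eqP; rewrite eq_le N0 andbT; move: h; rewrite mulrDl mul1r gerDl.
by rewrite pmulr_rle0.
Unshelve. all: by end_near. Qed.

End ProximalPoint.

(** * Averaged iterations and the Goebel-Kirk inequality *)

Section KrasnoselskiiMann.
Set Implicit Arguments. Unset Strict Implicit. Unset Printing Implicit Defensive.
Variables (R : realType) (n : nat) (N : 'rV[R]_n -> R).
Hypothesis Nn : is_norm N.
Variables (t : R) (x w : nat -> 'rV[R]_n).
Hypotheses (t0 : 0 < t) (t1 : t < 1).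
Hypothesis xS : forall k, x k.+1 = (1 - t) *: x k + t *: w k.
Hypothesis wN : forall i j, N (w i - w j) <= N (x i - x j).

Let r k := N (w k - x k).

Lemma averaged_step k : x k.+1 - x k = t *: (w k - x k).
Proof. by rewrite xS; apply/rowP => i; rewrite !mxE; ring. Qed.

(** The new residual vector is [w j.+1 - w j] plus [1 - t] times the old one, and nonexpansiveness
    bounds the first part by the step length [t * r j]. *)
Lemma averaged_residual_noninc k m : r (k + m) <= r k.
Proof.
elim: m => [|m IH]; first by rewrite addn0.
rewrite addnS; apply: le_trans IH; set j := (k + m)%N.
have [_ NZ ND] := Nn.
have -> : r j.+1 = N (w j.+1 - w j + (1 - t) *: (w j - x j)).
  by congr N; rewrite xS; apply/rowP => i; rewrite !mxE; ring.
apply: le_trans (ND _ _) _; apply: le_trans (lerD (wN _ _) (lexx _)) _.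
rewrite averaged_step !NZ !ger0_norm ?subr_ge0 ?(ltW t0) ?(ltW t1) //.
by rewrite -mulrDl addrC subrK mul1r.
Qed.

Lemma averaged_orbit_dist k m : N (x (k + m) - x k) <= m%:R * t * r k.
Proof.
have [_ NZ ND] := Nn.
elim: m => [|m IH]; first by rewrite addn0 subrr is_norm0 // !mul0r.
rewrite addnS -(subrK (x (k + m)) (x _.+1)) -addrA; apply: le_trans (ND _ _) _.
rewrite -natr1 !mulrDl mul1r [leRHS]addrC lerD // averaged_step NZ gtr0_norm //.
by rewrite ler_pM2l // averaged_residual_noninc.
Qed.

(** Follows inductively from [(1 - t) * (1 + (m + 1) * t) <= 1 + m * t]; it supplies the sign needed
    in the Goebel-Kirk induction. *)
Lemma bernoulli_inv m : 1 + m%:R * t <= ((1 - t) ^+ m)^-1.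
Proof.
have s0 : 0 < 1 - t by rewrite subr_gt0.
elim: m => [|m IH]; first by rewrite mul0r addr0 expr0 invr1.
rewrite exprS invfM [leRHS]mulrC ler_pdivlMr //; apply: le_trans IH.
rewrite -natr1; have := ler0n R m; nra.
Qed.

(** Induction on [m] for all [k] at once: the inequality at [k.+1] is carried back to [k] by
    expanding [x k.+1] as an average of [x k] and [w k]. *)
Lemma goebel_kirk m k :
  (1 + m%:R * t) * r k <=
  N (w (k + m) - x k) + ((1 - t) ^+ m)^-1 * (r k - r (k + m)).
Proof.
have [_ NZ ND] := Nn; have s0 : 0 < 1 - t by rewrite subr_gt0.
elim: m k => [|m IH] k.
  by rewrite addn0 mul0r addr0 mul1r subrr mulr0 addr0.
have := IH k.+1; rewrite addSnnS; set A' := N (w (k + m.+1) - x k.+1).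
set p := ((1 - t) ^+ m)^-1; set s := r (k + m.+1); set A := N _.
have hp : 1 + m%:R * t <= p := bernoulli_inv m.
have pE : ((1 - t) ^+ m.+1)^-1 = p / (1 - t) by rewrite exprS invfM mulrC.
have hr : r k.+1 <= r k by rewrite -[k.+1]addn1 averaged_residual_noninc.
have hA' : A' <= (1 - t) * A + t * ((m%:R + 1) * t * r k).
  have -> : A' = N ((1 - t) *: (w (k + m.+1) - x k) + t *: (w (k + m.+1) - w k)).
    by congr N; rewrite xS; apply/rowP => i; rewrite !mxE; ring.
  apply: le_trans (ND _ _) _; rewrite !NZ !gtr0_norm // lerD2l ler_pM2l //.
  by rewrite natr1; apply: le_trans (wN _ _) (averaged_orbit_dist _ _).
move=> IHk; rewrite pE -(ler_pM2l s0).
have -> : (1 - t) * (A + p / (1 - t) * (r k - s)) = (1 - t) * A + p * (r k - s).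
  by field; rewrite gt_eqF.
(* Since [p] dominates [1 + m * t], the change from [r k.+1] to [r k] is paid for by the term with
   factor [p]. *)
have : 0 <= (p - (1 + m%:R * t)) * (r k - r k.+1) by rewrite mulr_ge0 ?subr_ge0.
rewrite -natr1; move: IHk hA'; lra.
Qed.

(** If all residuals stayed above some [e > 0], the left side of the Goebel-Kirk inequality would
    grow with [m] while the distances on the right stay below a fixed [D]. *)
Lemma averaged_asymptotically_regular B :
  (forall k, N (x k) <= B) -> N (x k - x k.+1) @[k --> \oo] --> 0.
Proof.
move=> xB; have [_ NZ ND] := Nn; have s0 : 0 < 1 - t by rewrite subr_gt0.
have r0 k : 0 <= r k by exact: is_norm_ge0.
(* Residuals never increase, so one small residual controls the whole tail. *)
suff small e : 0 < e -> exists k, r k < e.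
  apply/cvgrPdist_lt => e /small[k hk]; exists k => // j /= kj.
  rewrite sub0r normrN ger0_norm ?is_norm_ge0 // is_norm_distC //.
  rewrite averaged_step NZ gtr0_norm //.
  apply: le_lt_trans hk; rewrite -/(r j) -(subnKC kj).
  apply: le_trans (averaged_residual_noninc k (j - k)).
  by rewrite ler_piMl // ltW.
move=> e0; apply: contrapT => hn.
have re k : e <= r k by rewrite leNgt; apply/negP => h; apply: hn; exists k.
pose D := r 0%N + (B + B).
have wD k m : N (w (k + m) - x k) <= D.
  rewrite -(subrK (x (k + m)) (w _)) -addrA; apply: le_trans (ND _ _) _.
  apply: lerD; first by rewrite -/(r _) -[X in r X]add0n averaged_residual_noninc.
  by apply: le_trans (ND _ _) _; rewrite (is_normN Nn) lerD.
have [m hm] : exists m : nat, D + 1 < (1 + m%:R * t) * e.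
  exists (Num.truncn ((D + 1) / (t * e))).+1.
  have := truncnS_gt ((D + 1) / (t * e)).
  rewrite ltr_pdivrMr ?mulr_gt0 // mulrA => /lt_trans; apply.
  by rewrite ltr_pM2r // ltrDr.
set p := ((1 - t) ^+ m)^-1; have p0 : 0 < p by rewrite invr_gt0 exprn_gt0.
have hi : has_inf (range r).
  by split; [exists (r 0%N), 0%N|exists 0 => _ [k _ <-]].
(* With [m] already fixed, [k] is chosen so that [r k] is within [1 / p] of the infimum; the
   amplified difference is then at most 1. *)
have [_ [k _ <-] hk] := inf_adherent (divr_gt0 ltr01 p0) hi.
have hkm : inf (range r) <= r (k + m) by apply: ge_inf; [case: hi|exists (k + m)%N].
have h1 : p * (r k - r (k + m)) <= 1.
  rewrite mulrC -ler_pdivlMr //; lra.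
have h2 : (1 + m%:R * t) * e <= (1 + m%:R * t) * r k.
  by rewrite ler_wpM2l // addr_ge0 // mulr_ge0 ?ler0n // ltW.
have := goebel_kirk m k; rewrite -/p; have := wD k m; lra.
Qed.

End KrasnoselskiiMann.

Lemma row_shift_sub (R : pzRingType) (n : nat) (u v : 'rV[R]_n) i s k :
  (u + s *: 'e_i - v) 0 k = (u - v) 0 k + s *+ (k == i).
Proof. by rewrite !mxE /= mulr_natr addrAC. Qed.

(** * Nonexpansiveness of the forward step in weighted l1 norms *)

Section WeightedL1.
Set Implicit Arguments. Unset Strict Implicit. Unset Printing Implicit Defensive.
Variables (R : realType) (n : nat) (eta : 'rV[R]_n).
Hypothesis eta0 : forall i, 0 < eta 0 i.
Local Notation N := (wnorm1 eta).

Lemma wnorm1_is_norm : is_norm N.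
Proof.
split=> [x /eqP|a x|x y].
- rewrite psumr_eq0 => [/allP h|i _]; last by rewrite mulr_ge0 // ltW.
  apply/rowP => i; rewrite mxE; have := h i (mem_index_enum _).
  by rewrite mulf_eq0 gt_eqF //= normr_eq0 => /eqP.
- by rewrite /wnorm1 mulr_sumr; apply: eq_bigr => i _; rewrite mxE normrM mulrCA.
- rewrite /wnorm1 -big_split; apply: ler_sum => i _.
  by rewrite /= -mulrDr mxE ler_pM2l // ler_normD.
Qed.

Variables (F : 'rV[R]_n -> 'rV[R]_n) (K : R).
Hypothesis K0 : 0 < K.
Hypothesis FK : forall u v, N (F u - F v) <= K * N (u - v).
Hypothesis Facc : forall alpha u v, 0 <= alpha ->
  N (u - v) <= N (u - v + alpha *: (F u - F v)).

(** For a short enough step along [f] no coordinate of [u - v] changes sign, so the norm is affine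
    there; its slope is the sum in question, and expansivity makes it nonnegative. *)
Lemma wnorm1_sign_ge0_lt (sigma u v : 'rV[R]_n) (e : R) : 0 < e ->
  (forall i, `|sigma 0 i| = 1) ->
  (forall i, e <= sigma 0 i * (u - v) 0 i) ->
  0 <= \sum_i eta 0 i * (sigma 0 i * (F u - F v) 0 i).
Proof.
move=> e0 sig1 sige; set d := u - v; set f := F u - F v.
(* [M] exceeds every [|f 0 i|], so [alpha *: f] moves each coordinate by at most the margin [e]. *)
pose M := 1 + \sum_i `|f 0 i|; pose alpha := e / M.
have M0 : 0 < M by rewrite ltr_pwDl // sumr_ge0.
have alpha0 : 0 < alpha by rewrite divr_gt0.
have := Facc u v (ltW alpha0); rewrite -/d -/f.
have normE i : `|d 0 i| = sigma 0 i * d 0 i.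
  by rewrite -[LHS]mul1r -(sig1 i) -normrM ger0_norm // (le_trans (ltW e0)) ?sige.
have normfE i : `|(d + alpha *: f) 0 i| = `|d 0 i| + alpha * (sigma 0 i * f 0 i).
  rewrite -[LHS]mul1r -(sig1 i) -normrM [(d + _) 0 i]mxE [(alpha *: f) 0 i]mxE.
  rewrite mulrDr normE [sigma 0 i * (alpha * _)]mulrCA ger0_norm //.
  have hf : alpha * `|f 0 i| <= e.
    rewrite /alpha mulrAC ler_pdivrMr // ler_pM2l // /M (bigD1 i) //=.
    by rewrite addrCA lerDl addr_ge0 // sumr_ge0.
  have : - (alpha * `|f 0 i|) <= alpha * (sigma 0 i * f 0 i).
    rewrite -mulrN ler_pM2l // -[`|f 0 i|]mul1r -(sig1 i) -normrM.
    by rewrite lerNl -normrN ler_norm.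
  have := sige i; rewrite -/d; lra.
rewrite /wnorm1 [leRHS](eq_bigr (fun i => eta 0 i * `|d 0 i|
  + alpha * (eta 0 i * (sigma 0 i * f 0 i)))); last first.
  by move=> i _; rewrite normfE mulrDr [_ * (alpha * _)]mulrCA.
by rewrite big_split -mulr_sumr lerDl /= pmulr_rge0.
Qed.

(* Moving [u] slightly along [sigma] makes the norm differentiable at [u - v],
   where expansivity of [Id + alpha F] determines the sign of the pairing. *)
Lemma wnorm1_sign_ge0 (sigma u v : 'rV[R]_n) :
  (forall i, `|sigma 0 i| = 1) ->
  (forall i, 0 <= sigma 0 i * (u - v) 0 i) ->
  0 <= \sum_i eta 0 i * (sigma 0 i * (F u - F v) 0 i).
Proof.
move=> sig1 sigd; apply/ler_addgt0Pr => e e0.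
(* Chosen so that the shift by [eps *: sigma] changes [F u] by at most [e] in norm. *)
pose M := 1 + K * N sigma; have N0 := is_norm_ge0 wnorm1_is_norm.
have M0 : 0 < M by rewrite ltr_pwDl // mulr_ge0 // ltW.
pose eps := e / M; have eps0 : 0 < eps by rewrite divr_gt0.
pose u' := u + eps *: sigma.
have h1 : 0 <= \sum_i eta 0 i * (sigma 0 i * (F u' - F v) 0 i).
  apply: (wnorm1_sign_ge0_lt eps0 sig1) => i; have := sigd i.
  have ss : sigma 0 i * sigma 0 i = 1 by rewrite -expr2 -real_normK ?num_real // sig1 expr1n.
  rewrite !mxE => h.
  suff -> : sigma 0 i * (u 0 i + eps * sigma 0 i - v 0 i) =
    sigma 0 i * (u 0 i - v 0 i) + eps by rewrite lerDr.
  by rewrite -[in RHS](mulr1 eps) -ss; ring.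
have h2 : \sum_i eta 0 i * (sigma 0 i * (F u' - F u) 0 i) <= e.
  apply: (@le_trans _ _ (N (F u' - F u))).
    apply: ler_sum => i _; rewrite ler_pM2l //; apply: le_trans (ler_norm _) _.
    by rewrite normrM sig1 mul1r.
  apply: le_trans (FK _ _) _; rewrite /u' addrAC subrr add0r.
  have [_ -> _] := wnorm1_is_norm; rewrite gtr0_norm // mulrCA /eps mulrAC.
  by rewrite ler_pdivrMr // ler_pM2l // /M lerDr.
apply: le_trans h1 _; apply: le_trans (lerD (lexx _) h2); rewrite -big_split /=.
by apply: ler_sum => i _; rewrite !mxE le_eqVlt; apply/orP; left; apply/eqP; ring.
Qed.

Variable gamma : R.
Hypotheses (gamma0 : 0 <= gamma) (gammaK : gamma * K <= 1).
Local Notation G := (fun u : 'rV[R]_n => u - gamma *: F u).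

(** The sign condition bounds the weighted sum of [|f 0 i|] over [i != j] by [eta 0 j * f 0 j]. What
    the forward step adds off the axis is thus offset by what it removes from coordinate [j]. *)
Lemma wnorm1_forward_coord (v : 'rV[R]_n) j s : N (G (v + s *: 'e_j) - G v) <= eta 0 j * `|s|.
Proof.
wlog s0 : v s / 0 <= s.
  move=> h; have [s0|s0] := leP 0 s; first exact: h.
  rewrite (is_norm_distC wnorm1_is_norm) -normrN.
  have := h (v + s *: 'e_j) (- s); rewrite scaleNr addrK; apply.
  by rewrite oppr_ge0 ltW.
set u := v + s *: 'e_j; set f := F u - F v.
have de i : (s *: 'e_j : 'rV[R]_n) 0 i = if i == j then s else 0.
  by rewrite !mxE /=; case: eqP; rewrite ?mulr1 ?mulr0.
have dE i : (u - v) 0 i = if i == j then s else 0 by rewrite /u addrAC subrr add0r de.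
(* Off the axis the increment is zero and either sign is admissible; the one opposite to [f] yields
   [- |f 0 i|]. *)
pose sigma : 'rV[R]_n := \row_i if (i == j) || (f 0 i <= 0) then 1 else -1.
have hsig : 0 <= \sum_i eta 0 i * (sigma 0 i * f 0 i).
  apply: wnorm1_sign_ge0 => i; first by rewrite mxE; case: ifP; rewrite ?normrN1 ?normr1.
  by rewrite dE mxE; case: (i == j); rewrite /= ?mul1r ?mulr0.
have Nd : N (u - v) = eta 0 j * s.
  rewrite /wnorm1 (bigD1 j) //= dE eqxx ger0_norm // big1 ?addr0 // => i /negPf ij.
  by rewrite dE ij normr0 mulr0.
(* The condition [gamma * K <= 1] prevents coordinate [j] from overshooting zero. *)
have fj : gamma * f 0 j <= s.
  rewrite -(ler_pM2l (eta0 j)) -Nd; apply: le_trans (_ : gamma * (K * N (u - v)) <= _).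
    apply: le_trans (ler_wpM2l gamma0 (FK u v)); rewrite mulrCA ler_wpM2l //.
    rewrite /wnorm1 (bigD1 j) //= -/f ler_wpDr ?sumr_ge0 // => [i _|].
      by rewrite mulr_ge0 // ltW.
    by rewrite ler_pM2l // ler_norm.
  by rewrite mulrA ler_piMl // is_norm_ge0 //; exact: wnorm1_is_norm.
have GE i : (G u - G v) 0 i = (if i == j then s else 0) - gamma * f 0 i.
  by rewrite -dE !mxE; ring.
rewrite /wnorm1 (bigD1 j) //= GE eqxx !ger0_norm ?subr_ge0 //.
move: hsig; rewrite (bigD1 j) //= {1}mxE eqxx /= mul1r => hsig.
suff -> : \sum_(i | i != j) eta 0 i * `|(G u - G v) 0 i| =
    - gamma * \sum_(i | i != j) eta 0 i * (sigma 0 i * f 0 i).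
  have := mulr_ge0 gamma0 hsig; lra.
rewrite mulr_sumr; apply: eq_bigr => i /negPf ij.
rewrite GE ij sub0r normrN normrM ger0_norm // [sigma _ _]mxE ij /=.
by case: (ler0P (f 0 i)) => _; ring.
Qed.

(* The weighted l1 norm is additive along a path parallel to the axes. *)
Lemma wnorm1_forward_nonexpansive (u v : 'rV[R]_n) : N (G u - G v) <= N (u - v).
Proof.
have [_ _ ND] := wnorm1_is_norm.
suff H (r : seq 'I_n) (d : 'rV[R]_n) : N (G (v + \sum_(j <- r) d 0 j *: 'e_j) - G v)
    <= \sum_(j <- r) eta 0 j * `|d 0 j|.
  by have := H (index_enum _) (u - v); rewrite -row_sum_delta [v + _]addrC subrK.
elim: r v => [|j r IH] w.
  by rewrite !big_nil addr0 subrr (is_norm0 wnorm1_is_norm).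
rewrite !big_cons addrA; pose w' := w + d 0 j *: 'e_j; rewrite -/w'.
apply: le_trans (lerD (wnorm1_forward_coord w j (d 0 j)) (IH w')).
rewrite -/w'; apply: le_trans (ND _ _).
by rewrite [X in _ <= N X]addrC [X in _ <= N X]addrA subrK.
Qed.

End WeightedL1.

(** * Nonexpansiveness of the forward step in weighted linf norms *)

Section WeightedLinf.
Set Implicit Arguments. Unset Strict Implicit. Unset Printing Implicit Defensive.
Variables (R : realType) (n : nat) (eta : 'rV[R]_n).
Hypothesis eta0 : forall i, 0 < eta 0 i.
Local Notation N := (wnorminf eta).

Lemma wnorminf_leP (x : 'rV[R]_n) M : 0 <= M ->
  reflect (forall i, `|x 0 i| <= eta 0 i * M) (N x <= M).
Proof.
move=> M0; apply: (iffP idP) => [/bigmax_leP[_ h] i|h].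
  by have := h i isT; rewrite ler_pdivrMr // mulrC.
by apply/bigmax_leP; split => // i _; rewrite ler_pdivrMr // mulrC h.
Qed.

Lemma wnorminf_ge0 (x : 'rV[R]_n) : 0 <= N x.
Proof. exact: bigmax_ge_id. Qed.

Lemma wnorminf_ge (x : 'rV[R]_n) i : `|x 0 i| <= eta 0 i * N x.
Proof. by have /wnorminf_leP := lexx (N x); apply; exact: wnorminf_ge0. Qed.

Lemma wnorminf_is_norm : is_norm N.
Proof.
split=> [x x0|a x|x y].
- apply/rowP => i; have := wnorminf_ge x i.
  by rewrite x0 mulr0 normr_le0 mxE => /eqP.
- have le b (z : 'rV[R]_n) : N (b *: z) <= `|b| * N z.
    apply/wnorminf_leP => [|i]; first by rewrite mulr_ge0 ?wnorminf_ge0.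
    by rewrite mxE normrM mulrCA ler_wpM2l // wnorminf_ge.
  apply/eqP; rewrite eq_le le /=; have [->|a0] := eqVneq a 0.
    by rewrite normr0 mul0r wnorminf_ge0.
  have := le a^-1 (a *: x); rewrite scalerA mulVf // scale1r normfV.
  by rewrite mulrC ler_pdivlMr ?normr_gt0 // mulrC.
- apply/wnorminf_leP => [|i]; first by rewrite addr_ge0 ?wnorminf_ge0.
  by rewrite mxE mulrDr (le_trans (ler_normD _ _)) // lerD // wnorminf_ge.
Qed.

Variables (F : 'rV[R]_n -> 'rV[R]_n) (K : R).
Hypothesis K0 : 0 < K.
Hypothesis FK : forall u v, N (F u - F v) <= K * N (u - v).
Hypothesis Facc : forall alpha u v, 0 <= alpha ->
  N (u - v) <= N (u - v + alpha *: (F u - F v)).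

(** The weights cancel: [s *: 'e_i] has norm [|s| / eta 0 i], and reading off coordinate [i]
    restores the factor [eta 0 i]. *)
Lemma wnorminf_lipschitz_coord (u : 'rV[R]_n) i s : `|F (u + s *: 'e_i) 0 i - F u 0 i| <= K * `|s|.
Proof.
have := wnorminf_ge (F (u + s *: 'e_i) - F u) i; rewrite !mxE => /le_trans; apply.
rewrite mulrC -ler_pdivlMr //; apply: le_trans (FK _ _) _.
rewrite -mulrA ler_pM2l // addrAC subrr add0r; apply/wnorminf_leP => [|k].
  by rewrite divr_ge0 // ltW.
rewrite !mxE /=; case: eqP => [->|_]; last by rewrite mulr0 normr0 mulr_ge0 ?divr_ge0 // ltW.
by rewrite mulr1 mulrC divfK // gt_eqF.
Qed.

(** If [f 0 i] were negative, a short step along [f] would lower the only peak while the other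
    coordinates stay within their slack; the norm would drop, against expansivity. *)
Lemma wnorminf_peak_lt (u v : 'rV[R]_n) i M e : 0 <= M -> 0 < e ->
  (forall k, k != i -> `|(u - v) 0 k| <= eta 0 k * M) ->
  (u - v) 0 i = eta 0 i * (M + e) -> F v 0 i <= F u 0 i.
Proof.
move=> M0 e0 hk hi; rewrite leNgt; apply/negP => Fi.
set d := u - v in hk hi *; set f := F u - F v.
(* Makes [alpha * N f < e], so the step cannot use up the gap [e] between the peak and [M]. *)
pose alpha := e / (2 * (1 + N f)); have Nf0 := wnorminf_ge0 f.
have alpha0 : 0 < alpha by rewrite divr_gt0 // mulr_gt0 // ltr_pwDl.
have alphaN : alpha * N f < e.
  rewrite /alpha mulrAC ltr_pdivrMr ?mulr_gt0 ?ltr_pwDl // ltr_pM2l //; lra.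
have fi : f 0 i < 0 by rewrite !mxE subr_lt0.
have Me0 : 0 < M + e by rewrite ltr_wpDl.
have afe k : `|alpha * f 0 k| < eta 0 k * e.
  apply: (@le_lt_trans _ _ (eta 0 k * (alpha * N f))); last by rewrite ltr_pM2l.
  by rewrite normrM gtr0_norm // mulrCA ler_pM2l // wnorminf_ge.
have : N (d + alpha *: f) < M + e.
  apply/bigmax_ltP; split => // k _; rewrite ltr_pdivrMr // mulrC.
  rewrite [(d + _) 0 k]mxE [(alpha *: f) 0 k]mxE; have [->|ki] := eqVneq k i.
    have afi : alpha * f 0 i < 0 by rewrite pmulr_rlt0.
    have em : 0 <= eta 0 i * M by rewrite mulr_ge0 // ltW.
    have := afe i; rewrite hi ltr0_norm // => fi'.
    rewrite ger0_norm; rewrite mulrDr; lra.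
  by apply: le_lt_trans (ler_normD _ _) _; rewrite mulrDr ler_ltD // hk.
apply/negP; rewrite -leNgt; apply: le_trans (Facc _ _ (ltW alpha0)).
have := wnorminf_ge d i; rewrite hi ger0_norm; first by rewrite ler_pM2l.
by rewrite mulr_ge0 // ltW.
Qed.

(* Raising coordinate [i] slightly makes it the only one attaining the norm. *)
Lemma wnorminf_peak (u v : 'rV[R]_n) i M :
  (forall k, `|(u - v) 0 k| <= eta 0 k * M) ->
  (u - v) 0 i = eta 0 i * M -> F v 0 i <= F u 0 i.
Proof.
move=> hk hi; have M0 : 0 <= M.
  by have := le_trans (normr_ge0 _) (hk i); rewrite pmulr_rge0.
apply/ler_addgt0Pr => e e0; pose s := e / K; have s0 : 0 < s by rewrite divr_gt0.
have := wnorminf_lipschitz_coord u i s; rewrite (gtr0_norm s0) [K * s]mulrC divfK ?gt_eqF //.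
move=> /(le_trans (ler_norm _)); rewrite lerBlDl; apply: le_trans.
apply: (@wnorminf_peak_lt _ _ _ M (s / eta 0 i)) => //; first by rewrite divr_gt0.
  by move=> k /negPf ki; rewrite row_shift_sub ki addr0.
by rewrite row_shift_sub hi eqxx mulr1n mulrDr [_ * (s / _)]mulrC divfK // gt_eqF.
Qed.

Variable gamma : R.
Hypotheses (gamma0 : 0 <= gamma) (gammaK : gamma * K <= 1).
Local Notation G := (fun u : 'rV[R]_n => u - gamma *: F u).

(* Raising coordinate [i] of [u] until it attains the norm makes
   [F u i - F v i] nonnegative, at a cost controlled by the Lipschitz constant. *)
Lemma wnorminf_forward_coord (u v : 'rV[R]_n) i : (G u - G v) 0 i <= eta 0 i * N (u - v).
Proof.
set M := N (u - v); pose s := eta 0 i * M - (u - v) 0 i.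
have s0 : 0 <= s by rewrite subr_ge0 (le_trans (ler_norm _)) // wnorminf_ge.
have hpeak : F v 0 i <= F (u + s *: 'e_i) 0 i.
  have hi : (u + s *: 'e_i - v) 0 i = eta 0 i * M.
    by rewrite row_shift_sub eqxx mulr1n addrC subrK.
  apply: (@wnorminf_peak _ _ _ M) => // k; have [->|/negPf ki] := eqVneq k i.
    by rewrite hi ger0_norm // mulr_ge0 ?wnorminf_ge0 // ltW.
  rewrite row_shift_sub ki addr0; exact: wnorminf_ge.
have := wnorminf_lipschitz_coord u i s; rewrite (ger0_norm s0).
move=> /(le_trans (ler_norm _)) => hL.
have h1 : F v 0 i - F u 0 i <= K * s by lra.
have h2 := ler_wpM2l gamma0 h1.
have h3 : gamma * (K * s) <= s by rewrite mulrA ler_piMl.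
move: h2 h3; rewrite {3}/s !mxE; lra.
Qed.

Lemma wnorminf_forward_nonexpansive (u v : 'rV[R]_n) : N (G u - G v) <= N (u - v).
Proof.
apply/wnorminf_leP => [|i]; first exact: wnorminf_ge0.
rewrite ler_norml wnorminf_forward_coord andbT lerNl.
rewrite (is_norm_distC wnorminf_is_norm u v); apply: le_trans (wnorminf_forward_coord v u i).
by rewrite !mxE; lra.
Qed.

End WeightedLinf.

(* With [t = alpha / (alpha + gamma)] the resolvent is the average
   [J = (1 - t) Id + t T] where [T = (Id - gamma F) o J] is nonexpansive. *)
Lemma prox_iter_averaged (R : realType) (n : nat) (N : 'rV[R]_n -> R)
  (F : 'rV[R]_n -> 'rV[R]_n) (alpha gamma : R) (x0 : 'rV[R]_n) (xs : nat -> 'rV[R]_n) :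
  is_norm N -> continuous F -> 0 < alpha -> 0 < gamma ->
  (forall u v, N (u - v) <= N (u - v + alpha *: (F u - F v))) ->
  (forall u v, N (u - gamma *: F u - (v - gamma *: F v)) <= N (u - v)) ->
  (exists z, F z = 0) -> prox_iter F alpha x0 xs ->
  exists z, F z = 0 /\ xs @ \oo --> z.
Proof.
move=> Nn Fc alpha0 gamma0 Facc FG [z Fz] xsP; have [_ NZ ND] := Nn.
have acc1 u v : 1 * N (u - v) <= N (u - v + alpha *: (F u - F v)) by rewrite mul1r.
have [con zcon] := prox_iter_contract xsP ltr01 acc1.
have xsz k : N (xs k - z) <= N (xs 0%N - z).
  elim: k => // k; apply: le_trans.
  by apply: le_trans (zcon _ _ Fz) _; rewrite invr1 mul1r.
have xsB k : N (xs k) <= N (xs 0%N - z) + N z.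
  by rewrite -{1}(subrK z (xs k)); apply: le_trans (ND _ _) _; rewrite lerD2r.
have ag0 : 0 < alpha + gamma by rewrite addr_gt0.
apply: (prox_iter_cvg Nn alpha0 xsP Fc Facc xsB).
pose w k := xs k.+1 - gamma *: F (xs k.+1).
apply: (@averaged_asymptotically_regular _ _ _ Nn (alpha / (alpha + gamma)) xs w _ _ _ _ _ xsB).
- by rewrite divr_gt0.
- by rewrite ltr_pdivrMr // mul1r ltrDl.
(* Substituting [xs k = xs k.+1 + alpha *: F (xs k.+1)], the weights [gamma] and [alpha] over
   [alpha + gamma] make the [F] terms cancel. *)
- move=> k; rewrite /w; case: xsP => _ /(_ k) <-.
  by apply/rowP => i; rewrite !mxE; field; rewrite gt_eqF.
- move=> i j; apply: le_trans (FG _ _) _.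
  by apply: le_trans (con _ _) _; rewrite invr1 mul1r.
Qed.

Theorem theorem28 (R : realType) (n : nat) (F : 'rV[R]_n -> 'rV[R]_n)
  (x0 : 'rV[R]_n) (Fcont : continuous F) :
  (* (i) *)
  (forall (N : 'rV[R]_n -> R) (c : R), is_norm N -> 0 < c -> monotone_with N F c ->
     forall (alpha : R) (xs : nat -> 'rV[R]_n), 0 < alpha -> prox_iter F alpha x0 xs ->
     exists xstar : 'rV[R]_n,
       [/\ F xstar = 0, (forall z, F z = 0 -> z = xstar),
           xs @ \oo --> xstar &
           forall k, N (xs k.+1 - xstar) <= (1 + alpha * c)^-1 * N (xs k - xstar)])
  /\
  (* (ii) *)
  (forall (N : 'rV[R]_n -> R), 
     (exists eta : 'rV[R]_n, (forall i, 0 < eta 0 i) /\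
        (N = wnorm1 eta \/ N = wnorminf eta)) ->
     monotone_with N F 0 -> lipschitz_wrt N F -> diagL F != 0 ->
     (exists z, F z = 0) ->
     forall (alpha : R) (xs : nat -> 'rV[R]_n), 0 < alpha -> prox_iter F alpha x0 xs ->
     exists xstar : 'rV[R]_n, F xstar = 0 /\ xs @ \oo --> xstar).
Proof.
split=> [N c Nn c0 Fm alpha xs alpha0 xsP|N [eta [eta0 NE]] Fm [L FL] _ zF alpha xs alpha0 xsP].
  exact: prox_iter_strong xsP c Fcont c0 Fm.
have Nn : is_norm N.
  by case: NE => ->; [exact: wnorm1_is_norm|exact: wnorminf_is_norm].
have Facc a u v : 0 <= a -> N (u - v) <= N (u - v + a *: (F u - F v)).
  by move=> a0; have := monotone_expansive Nn u v Fm a0; rewrite mulr0 addr0 mul1r.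
(* The given [L] may have any sign; a positive constant is required for [gamma = K^-1]. *)
pose K := 1 + `|L|; have K0 : 0 < K by rewrite ltr_pwDl.
have FK u v : N (F u - F v) <= K * N (u - v).
  apply: le_trans (FL _ _) _; rewrite ler_wpM2r ?(is_norm_ge0 Nn) //.
  by rewrite /K ler_wpDl // ler_norm.
have gamma0 : 0 < K^-1 by rewrite invr_gt0.
have gammaK : K^-1 * K <= 1 by rewrite mulVf // gt_eqF.
apply: (prox_iter_averaged Nn Fcont alpha0 gamma0 _ _ zF xsP).
  by move=> u v; apply: Facc; exact: ltW.
move=> u v; case: NE => NE; rewrite NE in FK Facc *.
  exact: (wnorm1_forward_nonexpansive eta0 K0 FK Facc (ltW gamma0) gammaK).
exact: (wnorminf_forward_nonexpansive eta0 K0 FK Facc (ltW gamma0) gammaK).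
Qed.
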